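(* Let $\Bbbk$ be a field, $H$ a Hopf $\Bbbk$-algebra, and $A$ a finite-dimensional unital associative $\Bbbk$-algebra which is either a left $H$-module algebra or a right $H$-comodule algebra, and which is tracial as an object of the category of finite-dimensional left $H$-modules, respectively right $H$-comodules. If $\mathrm{char}(\Bbbk)>0$, assume moreover that $\dim_{\Bbbk} A<\mathrm{char}(\Bbbk)$. Then the Jacobson radical $J(A)$ is $H$-invariant (in the module case), respectively $H$-coinvariant (in the comodule case).
   Context: $H$ has comultiplication $h\mapsto h_1\otimes h_2$ (Sweedler notation), counit $\varepsilon$ and antipode $S$. $A$ is an $H$-(co)module algebra if the multiplication $A\otimes A\to A$ and the unit $\Bbbk\to A$ are $H$-(co)module morphisms, tensor products carrying the usual diagonal (co)actions and $\Bbbk$ the trivial one. For a finite-dimensional $H$-(co)module $V$, $\mathrm{End}(V)\cong V\otimes V^*$ carries the induced (co)action, $V^*$ being the left dual: in the module case $(h\cdot T)(v)=h_1\cdot T(S(h_2)\cdot v)$; in the comodule case, writing coactions as $v\mapsto v_0\otimes v_1\in V\otimes H$, $T_0(v)\otimes T_1=T(v_0)_0\otimes T(v_0)_1S(v_1)$. $V$ is tracial if this induced (co)action preserves the trace functional $\mathrm{Tr}:\mathrm{End}(V)\cong V\otimes V^*\to\Bbbk$, i.e. $\mathrm{Tr}$ is a morphism of $H$-(co)modules to the trivial (co)module $\Bbbk$ (in formulas: $\mathrm{Tr}(h\cdot T)=\varepsilon(h)\mathrm{Tr}(T)$, respectively $\mathrm{Tr}(T_0)T_1=\mathrm{Tr}(T)1_H$).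 A subspace $W\le V$ is $H$-invariant if $H\cdot W\subseteq W$, respectively $H$-coinvariant if the coaction $\rho$ satisfies $\rho(W)\subseteq W\otimes H$ (i.e. $W$ is a sub-(co)module). *)

(* Defs.v *)
From HB Require Import structures.
From mathcomp Require Import all_boot all_order all_algebra all_field.
From mathcomp Require Import boolp classical_sets.

Set Implicit Arguments.
Unset Strict Implicit.
Unset Printing Implicit Defensive.

Import GRing.Theory.
Local Open Scope ring_scope.
Local Open Scope quotient_scope.

Reserved Notation "U ⊗ V" (at level 40, left associativity).

(* The tensor product U (x) V: formal sums of pairs, two of them being identified
   when no bilinear map separates them. *)
Section TensorType.
Variables (k : fieldType) (U V : lmodType k).
Implicit Types (s t : seq (U * V)) (W : lmodType k).

Definition psum W (f : U -> V -> W) s : W := \sum_(p <- s) f p.1 p.2.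

Definition tensor_eqv s t : bool :=
  `[< forall W (B : {bilinear U -> V -> W}), psum B s = psum B t >].

Lemma tensor_eqvP s t :
  reflect (forall W (B : {bilinear U -> V -> W}), psum B s = psum B t)
          (tensor_eqv s t).
Proof. exact: asboolP. Qed.

Lemma tensor_eqv_refl : reflexive tensor_eqv.
Proof. by move=> s; apply/tensor_eqvP. Qed.

Lemma tensor_eqv_sym : symmetric tensor_eqv.
Proof. by move=> s t; apply/tensor_eqvP/tensor_eqvP => h W B; rewrite h. Qed.

Lemma tensor_eqv_trans : transitive tensor_eqv.
Proof.
by move=> t s r /tensor_eqvP h1 /tensor_eqvP h2; apply/tensor_eqvP => W B; rewrite h1.
Qed.

Canonical tensor_equiv :=
  EquivRel tensor_eqv tensor_eqv_refl tensor_eqv_sym tensor_eqv_trans.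

Definition tensor : Type := {eq_quot tensor_equiv}.
HB.instance Definition _ := EqQuotient.on tensor.
HB.instance Definition _ := Choice.on tensor.

Lemma piTP s t : reflect (\pi_tensor s = \pi_tensor t) (tensor_eqv s t).
Proof. by apply: (iffP idP) => [h|/eqmodP//]; apply/eqmodP. Qed.

Lemma psum_cat W (f : U -> V -> W) s t : psum f (s ++ t) = psum f s + psum f t.
Proof. by rewrite /psum big_cat. Qed.

Definition scale_seq (a : k) s : seq (U * V) := [seq (a *: p.1, p.2) | p <- s].

Lemma psum_scale W (B : {bilinear U -> V -> W}) a s :
  psum B (scale_seq a s) = a *: psum B s.
Proof.
by rewrite /psum big_map scaler_sumr; apply: eq_bigr => p _; rewrite linearZl_LR.
Qed.

Lemma psum_repr W (B : {bilinear U -> V -> W}) s :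
  psum B (repr (\pi_tensor s)) = psum B s.
Proof.
have /piTP/tensor_eqvP -> // : \pi_tensor (repr (\pi_tensor s)) = \pi_tensor s.
by rewrite reprK.
Qed.

Definition tensor0 : tensor := \pi_tensor [::].
Definition tensor_add (x y : tensor) : tensor := \pi_tensor (repr x ++ repr y).
Definition tensor_scale (a : k) (x : tensor) : tensor :=
  \pi_tensor (scale_seq a (repr x)).
Definition tensor_opp (x : tensor) : tensor := tensor_scale (-1) x.

Lemma tensor_inj (x y : tensor) :
  (forall W (B : {bilinear U -> V -> W}), psum B (repr x) = psum B (repr y)) ->
  x = y.
Proof. by move=> h; rewrite -(reprK x) -(reprK y); apply/piTP/tensor_eqvP. Qed.

Lemma tensor_addA : associative tensor_add.
Proof.
by move=> x y z; apply: tensor_inj => W B; rewrite !(psum_repr, psum_cat) addrA.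
Qed.
Lemma tensor_addC : commutative tensor_add.
Proof. by move=> x y; apply: tensor_inj => W B; rewrite !(psum_repr, psum_cat) addrC. Qed.
Lemma tensor_add0 : left_id tensor0 tensor_add.
Proof.
by move=> x; apply: tensor_inj => W B; rewrite !(psum_repr, psum_cat) /psum big_nil add0r.
Qed.
Lemma tensor_addN : left_inverse tensor0 tensor_opp tensor_add.
Proof.
move=> x; apply: tensor_inj => W B.
by rewrite !(psum_repr, psum_cat, psum_scale) scaleN1r addNr /psum big_nil.
Qed.
HB.instance Definition _ :=
  GRing.isZmodule.Build tensor tensor_addA tensor_addC tensor_add0 tensor_addN.

Lemma tensor_scaleA a b (x : tensor) :
  tensor_scale a (tensor_scale b x) = tensor_scale (a * b) x.
Proof.
by apply: tensor_inj => W B; rewrite !(psum_repr, psum_scale) scalerA.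
Qed.
Lemma tensor_scale1 : left_id 1 tensor_scale.
Proof. by move=> x; apply: tensor_inj => W B; rewrite psum_repr psum_scale scale1r. Qed.
Lemma tensor_scaleDr : right_distributive tensor_scale +%R.
Proof.
move=> a x y; apply: tensor_inj => W B.
by rewrite !(psum_repr, psum_scale, psum_cat) scalerDr.
Qed.
Lemma tensor_scaleDl (x : tensor) : {morph tensor_scale^~ x : a b / a + b}.
Proof.
move=> a b; apply: tensor_inj => W B.
by rewrite !(psum_repr, psum_scale, psum_cat) scalerDl.
Qed.
HB.instance Definition _ := GRing.Zmodule_isLmodule.Build k tensor
  tensor_scaleA tensor_scale1 tensor_scaleDr tensor_scaleDl.

Definition ptensor (u : U) (v : V) : tensor := \pi_tensor [:: (u, v)].

(* The linear map U (x) V -> W induced by f : U -> V -> W.  The value is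
   independent of the representative only when f is bilinear. *)
Definition tlift W (f : U -> V -> W) (x : tensor) : W := psum f (repr x).

End TensorType.

Notation "U ⊗ V" := (tensor U%type V%type) : type_scope.
Notation "u ⊗ v" := (ptensor u v) : ring_scope.

Section TensorTheory.
Variables (k : fieldType) (U V : lmodType k).

Lemma ptensor_is_bilinear : bilinear_for *:%R *:%R (@ptensor k U V).
Proof.
split=> [v a u u'|u a v v']; apply: tensor_inj => W B;
  rewrite !(psum_repr, psum_cat, psum_scale) /psum !big_seq1 /=.
  by rewrite linearPl.
by rewrite linearPr.
Qed.

HB.instance Definition _ :=
  bilinear_isBilinear.Build k U V (U ⊗ V)%type *:%R *:%R (@ptensor k U V)
    ptensor_is_bilinear.

Lemma tensor_sum (x : U ⊗ V) : x = \sum_(p <- repr x) p.1 ⊗ p.2.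
Proof.
apply: tensor_inj => W B.
have aux (s : seq (U * V)) : psum B (repr (\sum_(p <- s) p.1 ⊗ p.2)) = psum B s.
  elim: s => [|p s IH]; first by rewrite big_nil psum_repr.
  by rewrite big_cons psum_repr psum_cat IH psum_repr /psum big_seq1 big_cons.
by rewrite aux.
Qed.

Section Lift.
Variables (W : lmodType k) (f : U -> V -> W).
Hypothesis f_bilin : bilinear_for *:%R *:%R f.

Let B : {bilinear U -> V -> W} :=
  HB.pack f (bilinear_isBilinear.Build k U V W *:%R *:%R f f_bilin).

Lemma tlift_is_linear : linear (tlift f).
Proof.
move=> a x y; rewrite /tlift.
by rewrite -[f]/(B : U -> V -> W) psum_repr psum_cat psum_repr psum_scale.
Qed.

Lemma tliftE u v : tlift f (u ⊗ v) = f u v.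
Proof. by rewrite /tlift -[f]/(B : U -> V -> W) psum_repr /psum big_seq1. Qed.

End Lift.

Lemma tlift_comb (W : lmodType k) (f g h : U -> V -> W) a (x : U ⊗ V) :
  (forall u v, f u v = a *: g u v + h u v) ->
  tlift f x = a *: tlift g x + tlift h x.
Proof.
move=> e; rewrite /tlift /psum scaler_sumr -big_split /=.
by apply: eq_bigr => p _; rewrite e.
Qed.

Lemma tensor_ext (W : lmodType k) (g h : U ⊗ V -> W) :
  linear g -> linear h -> (forall u v, g (u ⊗ v) = h (u ⊗ v)) -> g =1 h.
Proof.
move=> g_lin h_lin e x.
pose gl : {linear _ -> _} := HB.pack g (GRing.isLinear.Build k _ _ _ g g_lin).
pose hl : {linear _ -> _} := HB.pack h (GRing.isLinear.Build k _ _ _ h h_lin).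
rewrite (tensor_sum x) -[g]/(gl : _ -> _) -[h]/(hl : _ -> _) !linear_sum.
by apply: eq_bigr => p _; apply: e.
Qed.

End TensorTheory.

Definition tmap (k : fieldType) (U V U' V' : lmodType k)
    (f : U -> U') (g : V -> V') : U ⊗ V -> U' ⊗ V' :=
  tlift (fun u v => f u ⊗ g v).

(* Throughout, the Sweedler sum over h_1 (x) h_2 of F h_1 h_2 is written
   tlift (fun h1 h2 => F h1 h2) (comul h), and likewise for coactions. *)
Record hopfAlgType (k : fieldType) := HopfAlgType {
  hopf_alg :> algType k;
  comul : {linear hopf_alg -> (hopf_alg ⊗ hopf_alg)%type};
  counit : {scalar hopf_alg};
  antipode : {linear hopf_alg -> hopf_alg};
  comul_coassoc : forall h : hopf_alg,
    tlift (fun h1 h2 => tlift (fun x y => x ⊗ (y ⊗ h2)) (comul h1)) (comul h)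
    = tlift (fun h1 h2 => h1 ⊗ comul h2) (comul h);
  comul_counitl : forall h : hopf_alg, tlift (fun h1 h2 => counit h1 *: h2) (comul h) = h;
  comul_counitr : forall h : hopf_alg, tlift (fun h1 h2 => counit h2 *: h1) (comul h) = h;
  comul1 : comul 1 = 1 ⊗ 1;
  comulM : forall g h : hopf_alg,
    comul (g * h) =
      tlift (fun g1 g2 => tlift (fun h1 h2 => (g1 * h1) ⊗ (g2 * h2)) (comul h))
            (comul g);
  counit1 : counit 1 = 1;
  counitM : forall g h : hopf_alg, counit (g * h) = counit g * counit h;
  antipodel : forall h : hopf_alg,
    tlift (fun h1 h2 => antipode h1 * h2) (comul h) = (counit h)%:A;
  antipoder : forall h : hopf_alg,
    tlift (fun h1 h2 => h1 * antipode h2) (comul h) = (counit h)%:A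
}.

Arguments comul {k _}.
Arguments counit {k _}.
Arguments antipode {k _}.

Section Modules.
Variables (k : fieldType) (H : hopfAlgType k).

Definition is_hmodule (V : lmodType k) (act : H -> V -> V) : Prop :=
  [/\ bilinear_for *:%R *:%R act,
      forall v, act 1 v = v &
      forall g h v, act (g * h) v = act g (act h v)].

Definition is_hmod_morphism (V W : lmodType k) (actV : H -> V -> V)
    (actW : H -> W -> W) (f : V -> W) : Prop :=
  linear f /\ forall h v, f (actV h v) = actW h (f v).

Definition triv_act (h : H) (c : k^o) : k^o := counit h * c.

Definition tensor_act (V W : lmodType k) (actV : H -> V -> V)
    (actW : H -> W -> W) (h : H) : V ⊗ W -> V ⊗ W :=
  tlift (fun v w => tlift (fun h1 h2 => actV h1 v ⊗ actW h2 w) (comul h)).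

Definition is_module_algebra (A : algType k) (act : H -> A -> A) : Prop :=
  [/\ is_hmodule act,
      is_hmod_morphism (tensor_act act act) act (tlift (fun a b : A => a * b)) &
      is_hmod_morphism triv_act act (fun c : k^o => c%:A)].

End Modules.

Section Comodules.
Variables (k : fieldType) (H : hopfAlgType k).

Definition is_hcomodule (V : lmodType k) (rho : V -> V ⊗ H) : Prop :=
  [/\ linear rho,
      forall v, tlift (fun v0 v1 => tlift (fun w0 w1 => w0 ⊗ (w1 ⊗ v1)) (rho v0))
                      (rho v)
                = tlift (fun v0 v1 => v0 ⊗ comul v1) (rho v) &
      forall v, tlift (fun v0 v1 => counit v1 *: v0) (rho v) = v].

Definition is_hcomod_morphism (V W : lmodType k) (rhoV : V -> V ⊗ H)
    (rhoW : W -> W ⊗ H) (f : V -> W) : Prop :=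
  linear f /\ forall v, tmap f id (rhoV v) = rhoW (f v).

Definition triv_coact (c : k^o) : k^o ⊗ H := c ⊗ (1 : H).

Definition tensor_coact (V W : lmodType k) (rhoV : V -> V ⊗ H)
    (rhoW : W -> W ⊗ H) : V ⊗ W -> (V ⊗ W) ⊗ H :=
  tlift (fun v w => tlift (fun v0 v1 =>
    tlift (fun w0 w1 => (v0 ⊗ w0) ⊗ (v1 * w1)) (rhoW w)) (rhoV v)).

Definition is_comodule_algebra (A : algType k) (rho : A -> A ⊗ H) : Prop :=
  [/\ is_hcomodule rho,
      is_hcomod_morphism (tensor_coact rho rho) rho (tlift (fun a b : A => a * b)) &
      is_hcomod_morphism triv_coact rho (fun c : k^o => c%:A)].

End Comodules.

Definition trace (k : fieldType) (V : vectType k) (T : 'End(V)) : k^o :=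
  \sum_i coord (vbasis {:V}) i (T (vbasis {:V})`_i).

Section Tracial.
Variables (k : fieldType) (H : hopfAlgType k) (V : vectType k).

Definition end_act (act : H -> V -> V) (h : H) (T : 'End(V)) : 'End(V) :=
  linfun (fun v =>
    tlift (fun h1 h2 => act h1 (T (act (antipode h2) v))) (comul h)).

Definition tracial_module (act : H -> V -> V) : Prop :=
  is_hmod_morphism (end_act act) (@triv_act k H) (@trace k V).

(* v |-> T(v_0)_0 (x) T(v_0)_1 S(v_1) *)
Definition end_coact_at (rho : V -> V ⊗ H) (T : 'End(V)) (v : V) : V ⊗ H :=
  tlift (fun v0 v1 => tlift (fun w0 w1 => w0 ⊗ (w1 * antipode v1)) (rho (T v0)))
        (rho v).

Definition rank1 (i : 'I_(\dim {:V})) (w : V) : 'End(V) :=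
  linfun (fun v => coord (vbasis {:V}) i v *: w).

(* The element T_0 (x) T_1 of End(V) (x) H whose evaluation at each v is
   end_coact_at rho T v; see end_coactE and end_coact_uniq. *)
Definition end_coact (rho : V -> V ⊗ H) (T : 'End(V)) : 'End(V) ⊗ H :=
  \sum_i tmap (rank1 i) id (end_coact_at rho T (vbasis {:V})`_i).

Definition tracial_comodule (rho : V -> V ⊗ H) : Prop :=
  is_hcomod_morphism (end_coact rho) (@triv_coact k H) (@trace k V).

Lemma tmap_linear (k' : fieldType) (U1 V1 U2 V2 : lmodType k') (f : U1 -> U2)
    (g : V1 -> V2) : linear f -> linear g ->
  linear (tmap f g) /\ forall u v, tmap f g (u ⊗ v) = f u ⊗ g v.
Proof.
move=> fl gl.
have bil : bilinear_for *:%R *:%R (fun u v => f u ⊗ g v).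
  split=> [v a x y|u a x y]; first by rewrite fl linearPl.
  by rewrite gl linearPr.
by split; [apply: tlift_is_linear | apply: tliftE].
Qed.

Lemma id_linear (k' : fieldType) (U1 : lmodType k') : linear (@id U1).
Proof. by []. Qed.

Lemma rank1E i w v : rank1 i w v = coord (vbasis {:V}) i v *: w.
Proof.
pose f (v : V) := coord (vbasis {:V}) i v *: w.
have fl : linear f by move=> a x y; rewrite /f linearP scalerDl scalerA.
pose fL : {linear V -> V} := HB.pack f (GRing.isLinear.Build k _ _ _ f fl).
by rewrite /rank1 -[fun _ => _]/(fL : _ -> _) lfunE.
Qed.

Lemma rank1_linear i : linear (rank1 i).
Proof.
move=> a x y; apply/lfunP => v.
by rewrite add_lfunE scale_lfunE !rank1E scalerDr !scalerA mulrC.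
Qed.

Lemma ev_linear (v : V) : linear (fun F : 'End(V) => F v).
Proof. by move=> a x y; rewrite add_lfunE scale_lfunE. Qed.

Lemma end_actE (act : H -> V -> V) h T v : is_hmodule act ->
  end_act act h T v =
    tlift (fun h1 h2 => act h1 (T (act (antipode h2) v))) (comul h).
Proof.
case=> -[actl actr] _ _.
pose f (v : V) := tlift (fun h1 h2 => act h1 (T (act (antipode h2) v))) (comul h).
have fl : linear f.
  move=> a x y; apply: tlift_comb => h1 h2.
  by rewrite (actr _ a x y) linearP (actr _ a).
pose fL : {linear V -> V} := HB.pack f (GRing.isLinear.Build k _ _ _ f fl).
by rewrite /end_act -[fun _ => _]/(fL : _ -> _) lfunE.
Qed.

Lemma end_coact_at_linear rho T :
  is_hcomodule rho -> linear (end_coact_at rho T).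
Proof.
case=> rl _ _.
have inner v1 : bilinear_for *:%R *:%R
    (fun (w0 : V) (w1 : H) => w0 ⊗ (w1 * antipode v1)).
  split=> [w1 a x y|w0 a x y]; first by rewrite linearPl.
  by rewrite mulrDl -scalerAl linearPr.
have bil : bilinear_for *:%R *:%R (fun v0 v1 =>
    tlift (fun w0 w1 => w0 ⊗ (w1 * antipode v1)) (rho (T v0))).
  split=> [v1 a x y|v0 a x y].
    by rewrite linearP rl (tlift_is_linear (inner v1)).
  by apply: tlift_comb => w0 w1; rewrite linearP mulrDr -scalerAr linearPr.
by move=> a x y; rewrite /end_coact_at rl (tlift_is_linear bil).
Qed.

Lemma end_tensor_ev (X : 'End(V) ⊗ H) :
  X = \sum_i tmap (rank1 i) id
        (tmap (fun F : 'End(V) => F (vbasis {:V})`_i) id X).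
Proof.
have e i := tmap_linear (ev_linear (vbasis {:V})`_i) (@id_linear _ H).
have r i := tmap_linear (@rank1_linear i) (@id_linear _ H).
apply: (tensor_ext (g := id) (h := fun X => \sum_i tmap (rank1 i) id
  (tmap (fun F : 'End(V) => F (vbasis {:V})`_i) id X))) => // [a x y|F h].
  rewrite scaler_sumr -big_split; apply: eq_bigr => i _ /=.
  by rewrite (e i).1 (r i).1.
transitivity (\sum_i (rank1 i (F (vbasis {:V})`_i)) ⊗ h); last first.
  by apply: eq_bigr => i _; rewrite (e i).2 (r i).2.
rewrite -linear_sumlz; congr (_ ⊗ h); apply/lfunP => v.
rewrite sum_lfunE {1}(coord_vbasis (memvf v)) linear_sum.
by apply: eq_bigr => i _; rewrite rank1E linearZ.
Qed.

Lemma end_coactE rho T v : is_hcomodule rho ->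
  tmap (fun F : 'End(V) => F v) id (end_coact rho T) = end_coact_at rho T v.
Proof.
move=> rhoP.
pose g := tmap (fun F : 'End(V) => F v) (@id H).
have gP := tmap_linear (ev_linear v) (@id_linear _ H).
pose gL : {linear _ -> _} := HB.pack g (GRing.isLinear.Build k _ _ _ g gP.1).
pose f := end_coact_at rho T.
pose fL : {linear V -> _} :=
  HB.pack f (GRing.isLinear.Build k _ _ _ f (end_coact_at_linear T rhoP)).
rewrite -[LHS]/(gL _) linear_sum -[RHS]/(fL v).
rewrite [in RHS](coord_vbasis (memvf v)) linear_sum; apply: eq_bigr => i _.
rewrite linearZ_LR -[fL _]/(f _) -[end_coact_at _ _ _]/(f _); move: (f _) => x.
have r := tmap_linear (@rank1_linear i) (@id_linear _ H).
apply: (tensor_ext (g := fun x => gL (tmap (rank1 i) id x))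
  (h := fun x => coord (vbasis {:V}) i v *: x)) => [a y z|a y z|w h].
- by rewrite r.1 linearP.
- by rewrite scalerDr !scalerA mulrC.
by rewrite r.2 -[gL _]/(g _) /g gP.2 rank1E linearZl_LR.
Qed.

Lemma end_coact_uniq rho T (X : 'End(V) ⊗ H) :
  (forall v, tmap (fun F : 'End(V) => F v) id X = end_coact_at rho T v) ->
  X = end_coact rho T.
Proof.
by move=> h; rewrite (end_tensor_ev X); apply: eq_bigr => i _; rewrite h.
Qed.

End Tracial.

Section Invariant.
Variables (k : fieldType) (H : hopfAlgType k) (V : lmodType k).

Definition hinvariant (act : H -> V -> V) (W : set V) : Prop :=
  forall h w, W w -> W (act h w).

(* W (x) H as a subspace of V (x) H *)
Definition tensor_sub (W : set V) : set (V ⊗ H)%type :=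
  [set x | exists2 s : seq (V * H),
     (forall p, p \in s -> W p.1) & x = \sum_(p <- s) p.1 ⊗ p.2].

Definition hcoinvariant (rho : V -> V ⊗ H) (W : set V) : Prop :=
  forall w, W w -> tensor_sub W (rho w).

End Invariant.

Section Jacobson.
Variable R : nzRingType.

Definition left_ideal (I : set R) : Prop :=
  [/\ I 0, forall x y, I x -> I y -> I (x + y) & forall a x, I x -> I (a * x)].

Definition maximal_left_ideal (M : set R) : Prop :=
  [/\ left_ideal M, M <> setT &
      forall I, left_ideal I -> (M `<=` I)%classic -> I = M \/ I = setT].

Definition jacobson_radical : set R :=
  [set x | forall M, maximal_left_ideal M -> M x].

End Jacobson.

Arguments jacobson_radical R : clear implicits.

(* Main.v *)
Require Import Defs.
From HB Require Import structures.
From mathcomp Require Import all_boot all_order all_algebra all_field.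
From mathcomp Require Import boolp classical_sets.

(** Let [t a] be the trace of left multiplication by [a] on [A].  The theorem
holds because the Jacobson radical is the radical of the trace form,

  J = { x | t (x y) = 0 for all y },

so that it is determined by [t], and traciality makes [t] equivariant.

The inclusion of J in the radical of the form holds over every field: elements
of J are nilpotent, and a nilpotent matrix has trace zero.  Conversely, if [x]
is in the radical of the form, a power of [r x], with [r] a suitable polynomial
in [x], is an idempotent which acts as the identity on a power of [x]
([fitting_element]).  This idempotent has trace zero; but its trace is the rank
of its left multiplication, and a positive integer at most [\dim A] is nonzero
in [k] by the assumption on the characteristic.  The idempotent therefore
vanishes and [x] is nilpotent ([trace_radical_nilpotent]).  Hence the radical
of the form is a nil ideal, and lies in J ([jacobson_traceP]).

In a module algebra, [h1 (a (S(h2) b)) = (h a) b] ([act_mul_antipode]).  It says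
first that [a |-> (left multiplication by a)] is a morphism from [A] to
[End(A)], so that [t (h a) = eps(h) t a] by traciality; and then, applied
to [x] in J, that [t ((h x) y)] is the sum of the [eps(h1) t (x (S(h2) y))], all
of which vanish.

The comodule case is dual: from
[(a y_0)_0 (x) (a y_0)_1 S(y_1) = a_0 y (x) a_1] ([rho_mul_antipode]) one gets
[t(a_0) a_1 = t(a) 1] and then [t(x_0 y) x_1 = 0] for [x] in J and every [y].
As J is an intersection of kernels of linear forms, this puts the coaction of
[x] in J (x) H ([tensor_sub_kernel]). *)

Set Implicit Arguments.
Unset Strict Implicit.
Unset Printing Implicit Defensive.

Import GRing.Theory.
Local Open Scope ring_scope.

(** * Traces of nilpotent and idempotent matrices *)

Section MatrixTrace.
Variable F : fieldType.

(** With a rank factorization [N = C R], the matrix [R C] has the same trace, is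
again nilpotent, and is strictly smaller since a nilpotent matrix of positive
size is not invertible.  This avoids eigenvalues, hence any extension of [F]. *)
Lemma mxtrace_nilpotent n (N : 'M[F]_n) m : N ^+ m = 0 -> \tr N = 0.
Proof.
elim/ltn_ind: n => n IH in N m *; case: n => [|n] in N IH * => Nm0.
  by rewrite /mxtrace big_ord0.
have := rank_leq_row N; rewrite leq_eqVlt => /orP[full|small].
  have Nu : N \is a GRing.unit by rewrite -[_ \is a _]/(_ \in unitmx) -row_free_unit.
  by have := unitrX m Nu; rewrite Nm0 unitr0.
rewrite -(mulmx_base N) mxtrace_mulC; apply: (IH _ small _ m.+1).
have powRC j : (row_base N *m col_base N) ^+ j.+1
               = row_base N *m N ^+ j *m col_base N.
  elim: j => [|j IHj]; first by rewrite expr1 expr0 mulmx1.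
  rewrite exprS IHj [N ^+ j.+1]exprS -[X in X * N ^+ j](mulmx_base N).
  by rewrite -!mulmxE !mulmxA.
by rewrite powRC Nm0 mulmx0 mul0mx.
Qed.

(** In a rank factorization [E = C R] of an idempotent, cancelling [C] on the left
and [R] on the right of [C R C R = C R] leaves [R C = 1]. *)
Lemma mxtrace_idempotent n (E : 'M[F]_n) : E *m E = E -> \tr E = (\rank E)%:R.
Proof.
move=> EE; rewrite -[in LHS](mulmx_base E) mxtrace_mulC.
have /row_fullP[B BC] := col_base_full E.
have /row_freeP[D RD] := row_base_free E.
have CRCR : col_base E *m row_base E *m (col_base E *m row_base E)
            = col_base E *m row_base E by rewrite mulmx_base.
suff -> : row_base E *m col_base E = 1%:M by rewrite mxtrace1.
move: (col_base E) (row_base E) BC RD CRCR => C R BC RD CRCR.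
have := congr1 (fun X => B *m X *m D) CRCR.
by rewrite /= !mulmxA BC !mul1mx -!mulmxA RD mulmx1.
Qed.

End MatrixTrace.

(** * The regular representation and its trace *)

Section RegularRepresentation.
Variables (k : fieldType) (A : falgType k).
Implicit Types x y : A.

Local Notation e i := (vbasis {:A})`_i.

Definition lmul_mx x : 'M[k]_(\dim {:A}) :=
  \matrix_(i, j) coord (vbasis {:A}) i (x * e j).

Definition regular_trace x : k^o := \tr (lmul_mx x).

Lemma lmul_mxM x y : lmul_mx (x * y) = lmul_mx x *m lmul_mx y.
Proof.
apply/matrixP => i j; rewrite !mxE -mulrA {1}(coord_vbasis (memvf (y * e j))).
rewrite mulr_sumr linear_sum; apply: eq_bigr => l _ /=.
by rewrite -scalerAr linearZ /= !mxE mulrC.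
Qed.

Lemma lmul_mx1 : lmul_mx 1 = 1%:M.
Proof.
apply/matrixP => i j; rewrite !mxE mul1r coord_free; first by rewrite eq_sym.
by case/andP: (vbasisP {:A}).
Qed.

Lemma lmul_mxX x n : lmul_mx (x ^+ n) = lmul_mx x ^+ n.
Proof. by elim: n => [|n IH]; rewrite ?expr0 ?lmul_mx1 // !exprS lmul_mxM IH. Qed.

Lemma lmul_mx_eq0 x : lmul_mx x = 0 -> x = 0.
Proof.
move=> x0; rewrite -[x]mulr1 {1}(coord_vbasis (memvf 1)) mulr_sumr.
apply: big1 => j _; rewrite -scalerAr [x * _](coord_vbasis (memvf _)).
rewrite big1 ?scaler0 // => i _.
by move/matrixP/(_ i j): x0; rewrite !mxE => ->; rewrite scale0r.
Qed.

Lemma regular_trace_linear : linear regular_trace.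
Proof.
move=> a x y; rewrite /regular_trace /mxtrace scaler_sumr -big_split /=.
by apply: eq_bigr => i _; rewrite !mxE mulrDl -scalerAl linearP.
Qed.

HB.instance Definition _ :=
  GRing.isLinear.Build k A k^o *:%R regular_trace regular_trace_linear.

Lemma regular_traceC x y : regular_trace (x * y) = regular_trace (y * x).
Proof. by rewrite /regular_trace !lmul_mxM mxtrace_mulC. Qed.

Lemma trace_amull x : trace (amull x) = regular_trace x.
Proof. by apply: eq_bigr => i _; rewrite lfunE mxE. Qed.

Lemma regular_trace_nilpotent x n : x ^+ n = 0 -> regular_trace x = 0.
Proof.
move=> xn0; apply: (@mxtrace_nilpotent _ _ _ n); rewrite -lmul_mxX xn0.
by apply/matrixP => i j; rewrite !mxE mul0r linear0.
Qed.

(** The trace of an idempotent is a rank, thus an integer at most [\dim A]; this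
is where the bound on the dimension enters. *)
Lemma idempotent_trace0
    (dim_lt_char : forall p : nat, p \in [pchar k] -> (\dim {:A} < p)%N) x :
  x * x = x -> regular_trace x = 0 -> x = 0.
Proof.
move=> xx tx0; apply/lmul_mx_eq0/eqP; rewrite -mxrank_eq0.
have rk0 : (\rank (lmul_mx x))%:R = 0 :> k.
  by rewrite -mxtrace_idempotent // -lmul_mxM xx.
case: posnP => // rk_gt0.
have [p pk] := natf0_pchar rk_gt0 (introT eqP rk0).
have /(dvdn_leq rk_gt0) : (p %| \rank (lmul_mx x))%N by rewrite (dvdn_pcharf pk) rk0.
rewrite leqNgt => /negP[]; apply: leq_ltn_trans (dim_lt_char p pk).
exact: rank_leq_row.
Qed.

(** The first [\dim A + 1] powers of [x] are linearly dependent. *)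
Lemma annihilating_poly x : exists2 p : {poly k}, p != 0 & horner_alg x p = 0.
Proof.
pose n := (\dim {:A}).+1; pose X := [tuple x ^+ i | i < n].
have : ~ free X.
  rewrite /free => /eqP sz; have := dimvS (subvf <<X>>%VS).
  by rewrite sz size_tuple ltnn.
move=> dep; apply: contrapT => noP; apply: dep; apply/freeP => c c0 i.
pose p := \poly_(j < n) c (inord j).
have p0 : p = 0.
  apply/eqP/negPn/negP => pn0; apply: noP; exists p => //.
  rewrite -[RHS]c0 /p poly_def linear_sum; apply: eq_bigr => j _; rewrite nth_mktuple.
  by rewrite linearZ rmorphXn /= horner_algX inord_val mulr_algl.
by have := congr1 (fun q : {poly k} => q`_i) p0; rewrite coef_poly ltn_ord inord_val coef0.
Qed.

(** The Fitting decomposition of [x]: dividing an annihilating polynomial by the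
largest power of ['X] leaves a polynomial with nonzero constant term, that is
[1 - r x] up to a scalar.  Then [r x] acts as the identity on [x ^+ n.+1], so
high powers of [r x] are idempotent. *)
Lemma fitting_element x : exists r n, GRing.comm r x /\ x ^+ n.+1 * (1 - r * x) = 0.
Proof.
have [p pn0 px0] := annihilating_poly x.
have [n [q]] := multiplicity_XsubC p 0; rewrite pn0 /= => q0 pE.
have /factor_theorem[s sE] : root (q - (q.[0])%:P) 0.
  by rewrite /root !hornerE subrr.
have qE : q = q.[0]%:P + s * 'X by rewrite -['X]subr0 -polyC0 -sE addrC subrK.
pose f := horner_alg x.
pose r := f (- q.[0]^-1 *: s).
have rx : GRing.comm r x.
  by rewrite /GRing.comm /r -{1 2}(horner_algX x) -/f -!rmorphM mulrC.
exists r, n; split=> //.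
have <- : f (q.[0]^-1 *: q) = 1 - r * x.
  rewrite -{1}(horner_algX x) -/f -rmorphM -(rmorph1 f) -rmorphB.
  congr (f _); rewrite {2}qE scalerDr -!mul_polyC -polyCM mulVf // polyC1.
  by rewrite !mul_polyC -!scalerAl scaleNr opprK.
rewrite exprS -mulrA -{2}(horner_algX x) -rmorphXn -rmorphM /=.
rewrite -scalerAr ['X^n * q]mulrC.
by move: pE; rewrite polyC0 subr0 => <-; rewrite linearZ /= px0 !mulr0.
Qed.

End RegularRepresentation.

(** * The Jacobson radical is the radical of the trace form *)

Section JacobsonRadical.
Local Open Scope classical_set_scope.

Lemma jacobson_left_ideal (R : nzRingType) : left_ideal (jacobson_radical R).
Proof.
split=> [M [[]] // | x y Jx Jy M maxM | a x Jx M maxM];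
  case: (maxM) => -[M0 MD MM] _ _.
  by apply: MD; [apply: Jx | apply: Jy].
by apply: MM; apply: Jx.
Qed.

Variables (k : fieldType) (A : falgType k).
Implicit Types (x y u : A) (U : {vspace A}).

Lemma vspace_left_ideal_add U x : (forall a y, y \in U -> a * y \in U) ->
  forall a y, y \in (U + limg (amulr x))%VS -> a * y \in (U + limg (amulr x))%VS.
Proof.
move=> idU a _ /memv_addP[y yU [_ /memv_imgP[b _ ->] ->]].
rewrite mulrDr memv_add ?idU //; apply/memv_imgP; exists (a * b); rewrite ?memvf //.
by rewrite !lfunE /= mulrA.
Qed.

(** Since [A] has finite dimension, a subspace of largest dimension among the
proper left ideals containing [u] is maximal, even among left ideals given as
arbitrary sets: an element outside it generates with it a larger ideal. *)
Lemma maximal_left_ideal_exists u : (forall v, v * u <> 1) ->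
  exists2 M, maximal_left_ideal M & M u.
Proof.
move=> nlinv.
pose proper_ideal U := [/\ u \in U, forall a y, y \in U -> a * y \in U & 1 \notin U].
have [n /asboolP[U [uU idU U1] dimU] maxn] : exists2 n,
    `[< exists2 U, proper_ideal U & \dim U = n >] &
    forall m, `[< exists2 U, proper_ideal U & \dim U = m >] -> (m <= n)%N.
  pose P n := `[< exists2 U, proper_ideal U & \dim U = n >].
  have exP : exists n, P n.
    exists (\dim (limg (amulr u))); apply/asboolP; exists (limg (amulr u)) => //.
    split=> [|a _ /memv_imgP[b _ ->]|].
    - by apply/memv_imgP; exists 1; rewrite ?memvf // lfunE /= mul1r.
    - by apply/memv_imgP; exists (a * b); rewrite ?memvf // !lfunE /= mulrA.
    by apply/negP => /memv_imgP[v _]; rewrite lfunE /= => /esym/nlinv.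
  have ubP n : P n -> (n <= \dim {:A})%N.
    by move=> /asboolP[U _ <-]; apply/dimvS/subvf.
  by case: (ex_maxnP exP ubP) => n Pn maxn; exists n.
exists [set x | x \in U] => //; split.
- by split=> [|x y|a x] /=; [apply: mem0v | apply: memvD | apply: idU].
- move=> UT; move/negP: U1; apply.
  by have : [set x | x \in U] (1 : A) by rewrite UT.
move=> I [I0 ID IM] UI.
have [IU|/existsNP[x /not_implyP[Ix /negP xU]]] := pselect (I `<=` [set x | x \in U]).
  by left; apply/seteqP.
right; pose V := (U + limg (amulr x))%VS.
have UV : (U <= V)%VS by apply: addvSl.
have xV : x \in V.
  apply/(subvP (addvSr _ _))/memv_imgP; exists 1; rewrite ?memvf //.
  by rewrite lfunE /= mul1r.
have VI y : y \in V -> I y.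
  move=> /memv_addP[z zU [_ /memv_imgP[b _ ->] ->]].
  by rewrite lfunE; apply: ID; [apply: UI | apply: IM].
have V1 : 1 \in V.
  apply/negPn/negP => V1.
  have /maxn : `[< exists2 U', proper_ideal U' & \dim U' = \dim V >].
    apply/asboolP; exists V => //; split=> //; first exact: (subvP UV).
    exact: vspace_left_ideal_add.
  rewrite -dimU => dimVU; move/negP: xU; apply.
  by have /eqP -> : U == V by rewrite eqEdim UV.
by apply/seteqP; split=> // y _; rewrite -[y]mulr1; apply/IM/VI.
Qed.

(** For [x] in the radical, [1 - r x] lies in no maximal left ideal, so it has a
left inverse; in the relation of [fitting_element] it can be cancelled. *)
Lemma jacobson_nilpotent x : jacobson_radical A x -> exists n, x ^+ n = 0.
Proof.
move=> Jx; have [r [n [rx xn]]] := fitting_element x.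
have [[v vu]|nlinv] := pselect (exists v, v * (1 - r * x) = 1).
  exists n.+1; rewrite -[LHS]mul1r -vu -mulrA.
  suff -> : (1 - r * x) * x ^+ n.+1 = x ^+ n.+1 * (1 - r * x) by rewrite xn mulr0.
  apply/commrX/commr_sym/commrD; first exact: commr1.
  apply/commrN/commrM; last exact: commr_refl.
  exact/commr_sym.
have [v vu|M maxM Mu] := @maximal_left_ideal_exists (1 - r * x).
  by apply: nlinv; exists v.
case: (maxM) => -[M0 MD MM] MT _; case: MT; apply/seteqP; split=> // y _.
by rewrite -[y]mulr1 -(subrK (r * x) 1); apply/MM/MD/MM => //; apply: Jx.
Qed.

(** The idempotent [e] obtained from [fitting_element] is a multiple of [x], so its
trace is zero, and [e] fixes a power of [x]. *)
Lemma trace_radical_nilpotent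
    (dim_lt_char : forall p : nat, p \in [pchar k] -> (\dim {:A} < p)%N) x :
  (forall y, regular_trace (x * y) = 0) -> exists n, x ^+ n = 0.
Proof.
move=> tx0; have [r [n [rx xn]]] := fitting_element x; exists n.+1.
pose s := r * x.
have sx : GRing.comm s x by apply/commr_sym/commrM; [exact/commr_sym | exact: commr_refl].
have xs : x ^+ n.+1 * s = x ^+ n.+1.
  by apply/esym/eqP; rewrite -subr_eq0 -[X in X - _]mulr1 -mulrBr xn.
have fix_s j : x ^+ n.+1 * s ^+ j = x ^+ n.+1.
  elim: j => [|j IH]; first by rewrite mulr1.
  by rewrite [s ^+ _]exprS mulrA xs.
pose e := s ^+ n.+1.
have eE : e = r ^+ n.+1 * x ^+ n.+1 by rewrite /e /s exprMn_comm.
suff e0 : e = 0 by rewrite -(fix_s n.+1) -/e e0 mulr0.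
apply: (idempotent_trace0 dim_lt_char); first by rewrite {1}eE -mulrA fix_s -eE.
by rewrite eE regular_traceC exprS -mulrA tx0.
Qed.

(** For the radical of the form inside J: an [x] of it outside a maximal left
ideal [M] would give [1 = m + a x] with [m] in [M] and [a x] nilpotent, making [m] invertible. *)
Lemma jacobson_traceP
    (dim_lt_char : forall p : nat, p \in [pchar k] -> (\dim {:A} < p)%N) x :
  jacobson_radical A x <-> forall y, regular_trace (x * y) = 0.
Proof.
have [J0 JD JM] := jacobson_left_ideal A.
split=> [Jx y|tx0 M [[M0 MD MM] MT maxM]].
  rewrite regular_traceC; have [n yxn] := jacobson_nilpotent (JM y x Jx).
  exact: regular_trace_nilpotent yxn.
apply: contrapT => Mx.
pose I : set A := [set z | exists m a, M m /\ z = m + a * x].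
have [||IM|IT] := maxM I.
- split=> [|z z' [m [a [Mm ->]]] [m' [a' [Mm' ->]]]|b z [m [a [Mm ->]]]].
  + by exists 0, 0; rewrite mul0r addr0.
  + exists (m + m'), (a + a'); split; first exact: MD.
    by rewrite mulrDl addrACA.
  by exists (b * m), (b * a); split; [apply: MM | rewrite mulrDr mulrA].
- by move=> m Mm; exists m, 0; rewrite mul0r addr0.
- by apply: Mx; rewrite -IM; exists 0, 1; rewrite mul1r add0r.
have [m [a [Mm m1]]] : I 1 by rewrite IT.
have [n axn] : exists n, (a * x) ^+ n = 0.
  apply: (trace_radical_nilpotent dim_lt_char) => y.
  by rewrite -mulrA regular_traceC -mulrA tx0.
apply: MT; apply/seteqP; split=> // y _.
have mE : m = 1 - a * x by rewrite m1 addrK.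
pose q := \sum_(i < n) (a * x) ^+ i.
have qm : q * m = 1.
  have -> : q * m = m * q.
    apply/commr_sym/commr_sum => i _; rewrite mE; apply/commrX/commr_sym.
    by apply: commrD; [exact: commr1 | apply/commrN/commr_refl].
  by rewrite mE -opprB mulNr -subrX1 axn sub0r opprK.
by rewrite -[y]mulr1 -qm mulrA; apply: MM.
Qed.

End JacobsonRadical.

(** * Linear maps and kernels on tensor products *)

Section TensorComplements.
Variable k : fieldType.

(** No bilinearity is asked of [f], because a lift is by definition a finite sum
over one fixed representative.  Sweedler sums can thus be rewritten termwise,
and bilinearity matters only where a representative is replaced. *)
Lemma linear_tlift (U V W W' : lmodType k) (g : W -> W') (f : U -> V -> W) x :
  linear g -> g (tlift f x) = tlift (fun u v => g (f u v)) x.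
Proof.
move=> g_lin.
pose gl : {linear _ -> _} := HB.pack g (GRing.isLinear.Build k _ _ _ g g_lin).
by rewrite /tlift /psum -[g]/(gl : _ -> _) linear_sum.
Qed.

Lemma eq_tlift (U V W : lmodType k) (f g : U -> V -> W) x :
  (forall u v, f u v = g u v) -> tlift f x = tlift g x.
Proof. by move=> fg; apply: eq_bigr => p _. Qed.

Lemma exchange_tlift (U V U' V' W : lmodType k) (f : U -> V -> U' -> V' -> W) x y :
  tlift (fun u v => tlift (f u v) y) x
  = tlift (fun u' v' => tlift (fun u v => f u v u' v') x) y.
Proof. exact: exchange_big. Qed.

(** The kernels of the [phi j (x) id] meet in (intersection of the kernels of the
[phi j]) (x) H.  Write [z] as the sum of the [e_i (x) h_i] for a basis [e_i] of
[V]; the hypothesis is [h G = 0] for the row [h] and the matrix [G] of the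
[phi j e_i].  With [P = 1 - G G'], for a pseudo-inverse [G'], one has [h = h P]
and [P G = 0]: moving [P] across the tensor sign replaces each [e_i] by a vector
killed by all the [phi j].  No basis of [H] has to be chosen. *)
Lemma tensor_sub_kernel (V : vectType k) (H : hopfAlgType k) m
    (phi : 'I_m -> {scalar V}) (z : V ⊗ H) :
  (forall j, tlift (fun v w => phi j v *: w) z = 0) ->
  tensor_sub [set v | forall j, phi j v = 0]%classic z.
Proof.
move=> phi0; set e := vbasis {:V}.
pose h i := tlift (fun v w => coord e i v *: w) z.
pose G : 'M_(\dim {:V}, m) := \matrix_(i, j) phi j e`_i.
pose P := 1%:M - G *m pinvmx G.
have PG : P *m G = 0 by rewrite mulmxBl mul1mx mulmxKpV ?submx_refl // subrr.
have zE : z = \sum_(i < \dim {:V}) e`_i ⊗ h i.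
  rewrite {1}(tensor_sum z); under [RHS]eq_bigr => i _ do rewrite linear_sumr.
  rewrite exchange_big; apply: eq_bigr => p _ /=.
  rewrite [in LHS](coord_vbasis (memvf p.1)) linear_sumlz.
  by apply: eq_bigr => i _; rewrite linearZl_LR linearZr_LR.
have hG j : \sum_i G i j *: h i = 0.
  rewrite -[RHS](phi0 j) /h /tlift /psum.
  under eq_bigr => i _ do rewrite scaler_sumr.
  rewrite exchange_big; apply: eq_bigr => p _ /=.
  rewrite [in RHS](coord_vbasis (memvf p.1)) linear_sum scaler_suml.
  by apply: eq_bigr => i _; rewrite mxE scalerA mulrC [phi j (_ *: _)]linearZ.
have hP l : h l = \sum_i P i l *: h i.
  rewrite -[LHS](subr0) -[X in _ - X](_ : \sum_i (G *m pinvmx G) i l *: h i = 0).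
    rewrite (_ : h l = \sum_i (1%:M : 'M[k]_(\dim {:V})) i l *: h i).
      by rewrite -sumrB; apply: eq_bigr => i _; rewrite -scalerBl !mxE.
    rewrite (bigD1 l) //= mxE eqxx scale1r big1 ?addr0 // => i il.
    by rewrite mxE (negPf il) scale0r.
  under eq_bigr => i _ do rewrite mxE scaler_suml.
  rewrite exchange_big big1 // => j _ /=.
  transitivity (pinvmx G j l *: \sum_i G i j *: h i); last by rewrite hG scaler0.
  by rewrite scaler_sumr; apply: eq_bigr => i _; rewrite scalerA mulrC.
pose f i := \sum_(l < \dim {:V}) P i l *: e`_l.
exists [seq (f i, h i) | i <- enum 'I_(\dim {:V})].
  move=> _ /mapP[i _ ->] j /=; rewrite linear_sum.
  transitivity ((P *m G) i j); last by rewrite PG mxE.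
  by rewrite mxE; apply: eq_bigr => l _; rewrite linearZ [G l j]mxE.
rewrite big_map big_enum zE /=.
under eq_bigr => l _ do rewrite hP linear_sumr.
rewrite exchange_big; apply: eq_bigr => i _ /=.
by rewrite /f linear_sumlz; apply: eq_bigr => l _; rewrite linearZl_LR linearZr_LR.
Qed.

End TensorComplements.

(** * Multiplication against the antipode *)

Section HopfComplements.
Variables (k : fieldType) (H : hopfAlgType k).

Definition mul_antipode : H ⊗ H -> H := tlift (fun x y => x * antipode y).

Lemma mul_antipode_bilinear : bilinear_for *:%R *:%R (fun x y : H => x * antipode y).
Proof.
split=> [y a x x'|x a y y']; first by rewrite mulrDl -scalerAl.
by rewrite linearP mulrDr -scalerAr.
Qed.

Lemma mul_antipode_linear : linear mul_antipode.
Proof. exact: tlift_is_linear mul_antipode_bilinear. Qed.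

Lemma mul_antipodeE x y : mul_antipode (x ⊗ y) = x * antipode y.
Proof. exact: tliftE mul_antipode_bilinear _ _. Qed.

Lemma mul_antipode_comul h : mul_antipode (comul h) = (counit h)%:A.
Proof. exact: antipoder. Qed.

End HopfComplements.

Lemma mul_bilinear (k : fieldType) (A : algType k) :
  bilinear_for *:%R *:%R (fun a b : A => a * b).
Proof.
by split=> [b c a a'|a c b b']; rewrite ?mulrDl ?mulrDr -?scalerAl -?scalerAr.
Qed.

(** * The module case *)

Section ModuleAlgebra.
Variables (k : fieldType) (H : hopfAlgType k) (A : falgType k) (act : H -> A -> A).
Hypothesis actP : is_module_algebra act.

Let act_mod : is_hmodule act. Proof. by case: actP. Qed.
Let act_linearl v : linear (act^~ v). Proof. by case: act_mod => -[]. Qed.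
Let act_linearr h : linear (act h). Proof. by case: act_mod => -[]. Qed.
Let actM g h v : act (g * h) v = act g (act h v). Proof. by case: act_mod. Qed.

Lemma act_mul h a b :
  act h (a * b) = tlift (fun h1 h2 => act h1 a * act h2 b) (comul h).
Proof.
case: actP => _ [_ mulP] _; have mulb := mul_bilinear A.
have := mulP h (a ⊗ b); rewrite (tliftE mulb) => <-.
rewrite /tensor_act tliftE; last first.
  split=> [w c x y|v c x y]; apply: tlift_comb => h1 h2.
    by rewrite act_linearr linearPl.
  by rewrite act_linearr linearPr.
rewrite (linear_tlift _ _ (tlift_is_linear mulb)).
by apply: eq_tlift => h1 h2; rewrite (tliftE mulb).
Qed.

(** Expanding the action on the product gives [(h1 a) (h2 S(h3) b)], by
coassociativity, and the last two factors collapse to the counit.  The bilinear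
map [F] is what has to be applied to the coassociativity identity. *)
Lemma act_mul_antipode h a b :
  tlift (fun h1 h2 => act h1 (a * act (antipode h2) b)) (comul h) = act h a * b.
Proof.
pose F (x : H) w := act x a * act (mul_antipode w) b.
have Fb : bilinear_for *:%R *:%R F.
  split=> [w c x y|x c w w']; first by rewrite /F act_linearl mulrDl -scalerAl.
  by rewrite /F mul_antipode_linear act_linearl mulrDr -scalerAr.
have FL := tlift_is_linear Fb.
have := congr1 (tlift F) (comul_coassoc h).
rewrite !(linear_tlift _ _ FL) => E.
transitivity (tlift (fun h1 h2 => tlift F
    (tlift (fun x y => x ⊗ (y ⊗ h2)) (comul h1))) (comul h)).
  apply: eq_tlift => h1 h2; rewrite act_mul (linear_tlift _ _ FL).
  by apply: eq_tlift => x y; rewrite (tliftE Fb) /F mul_antipodeE actM.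
rewrite {}E -[in RHS](comul_counitr h).
rewrite (@linear_tlift _ _ _ _ _ (fun x => act x a * b)); last first.
  by move=> c x y; rewrite act_linearl mulrDl -scalerAl.
apply: eq_tlift => h1 h2; rewrite (tliftE Fb) /F mul_antipode_comul.
have act0 v : act 0 v = 0.
  by have := act_linearl v (-1) 0 0; rewrite scaler0 addr0 scaleN1r addNr.
have actZ c x v : act (c *: x) v = c *: act x v.
  by have := act_linearl v c x 0; rewrite act0 !addr0.
have act1 v : act 1 v = v by case: act_mod.
by rewrite !actZ act1 -scalerAl -scalerAr.
Qed.

Lemma end_act_amull h a : end_act act h (amull a) = amull (act h a).
Proof.
apply/lfunP => v; rewrite end_actE // [RHS]lfunE /= -act_mul_antipode.
by apply: eq_tlift => h1 h2; rewrite lfunE.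
Qed.

Hypothesis act_tracial : tracial_module act.

Lemma regular_trace_act h a : regular_trace (act h a) = counit h * regular_trace a.
Proof. by rewrite -!trace_amull -end_act_amull act_tracial.2. Qed.

Lemma trace_radical_hinvariant :
  hinvariant act [set x | forall y, regular_trace (x * y) = 0]%classic.
Proof.
move=> h x tx0 y; rewrite -act_mul_antipode.
rewrite (linear_tlift _ _ (@regular_trace_linear _ A)).
by apply: big1 => p _; rewrite regular_trace_act tx0 mulr0.
Qed.

End ModuleAlgebra.

(** * The comodule case *)

Section ComoduleAlgebra.
Variables (k : fieldType) (H : hopfAlgType k) (A : falgType k) (rho : A -> A ⊗ H).
Hypothesis rhoP : is_comodule_algebra rho.

Let rho_comod : is_hcomodule rho. Proof. by case: rhoP. Qed.
Let rho_linear : linear rho. Proof. by case: rho_comod. Qed.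

Lemma mulr_right_bilinear (V : lmodType k) (s : H) :
  bilinear_for *:%R *:%R (fun (v : V) (h : H) => v ⊗ (h * s)).
Proof.
split=> [h c v v'|v c h h']; first by rewrite linearPl.
by rewrite mulrDl -scalerAl linearPr.
Qed.

Lemma rho_mul a b : rho (a * b) =
  tlift (fun a0 a1 => tlift (fun b0 b1 => (a0 * b0) ⊗ (a1 * b1)) (rho b)) (rho a).
Proof.
case: rhoP => _ [_ mulP] _; have mulb := mul_bilinear A.
have := mulP (a ⊗ b); rewrite (tliftE mulb) => <-.
rewrite /tensor_coact tliftE; last first.
  have bil (a0 : A) (a1 : H) : bilinear_for *:%R *:%R
      (fun (w0 : A) (w1 : H) => (a0 ⊗ w0) ⊗ (a1 * w1)).
    split=> [w1 c x y|w0 c x y]; first by rewrite linearPr linearPl.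
    by rewrite mulrDr -scalerAr linearPr.
  have bil' w : bilinear_for *:%R *:%R (fun (v0 : A) (v1 : H) =>
      tlift (fun w0 w1 => (v0 ⊗ w0) ⊗ (v1 * w1)) (rho w)).
    split=> [v1 c x y|v0 c x y]; apply: tlift_comb => w0 w1.
      by rewrite !linearPl.
    by rewrite mulrDl -scalerAl linearPr.
  split=> [w c x y|v c x y]; first by rewrite rho_linear (tlift_is_linear (bil' w)).
  apply: tlift_comb => v0 v1.
  by rewrite rho_linear (tlift_is_linear (bil v0 v1)).
have [tL tE] := tmap_linear (tlift_is_linear mulb) (@id_linear _ H).
rewrite (linear_tlift _ _ tL); apply: eq_tlift => a0 a1.
rewrite (linear_tlift _ _ tL); apply: eq_tlift => b0 b1.
by rewrite tE (tliftE mulb).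
Qed.

(** As in [act_mul_antipode], the left side is [a_0 y_0 (x) a_1 y_1 S(y_2)]. *)
Lemma rho_mul_antipode a y :
  tlift (fun y0 y1 => tlift (fun w0 w1 => w0 ⊗ (w1 * antipode y1)) (rho (a * y0)))
        (rho y)
  = tlift (fun a0 a1 => (a0 * y) ⊗ a1) (rho a).
Proof.
transitivity (tlift (fun y0 y1 => tlift (fun a0 a1 => tlift (fun b0 b1 =>
    (a0 * b0) ⊗ (a1 * (b1 * antipode y1))) (rho y0)) (rho a)) (rho y)).
  apply: eq_tlift => y0 y1; have bil := mulr_right_bilinear A (antipode y1).
  have L := tlift_is_linear bil.
  rewrite rho_mul (linear_tlift _ _ L); apply: eq_tlift => a0 a1.
  rewrite (linear_tlift _ _ L); apply: eq_tlift => b0 b1.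
  by rewrite (tliftE bil) mulrA.
rewrite exchange_tlift; apply: eq_tlift => a0 a1.
(* The sum over the coaction of [a] has been pulled out, so only that of [y],
   to which coassociativity applies, remains. *)
pose F (v : A) (w : H ⊗ H) := (a0 * v) ⊗ (a1 * mul_antipode w).
have Fb : bilinear_for *:%R *:%R F.
  split=> [w c x z|x c w w']; rewrite /F.
    by rewrite mulrDr -scalerAr linearPl.
  by rewrite mul_antipode_linear mulrDr -scalerAr linearPr.
have FL := tlift_is_linear Fb.
have [_ coassoc counitP] := rho_comod.
have := congr1 (tlift F) (coassoc y).
rewrite !(linear_tlift _ _ FL) => E.
transitivity (tlift (fun y0 y1 => tlift F
    (tlift (fun b0 b1 => b0 ⊗ (b1 ⊗ y1)) (rho y0))) (rho y)).
  apply: eq_tlift => y0 y1; rewrite (linear_tlift _ _ FL).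
  by apply: eq_tlift => b0 b1; rewrite (tliftE Fb) /F mul_antipodeE.
rewrite {}E -[in RHS](counitP y).
rewrite (@linear_tlift _ _ _ _ _ (fun v => (a0 * v) ⊗ a1)); last first.
  by move=> c x z; rewrite mulrDr -scalerAr linearPl.
apply: eq_tlift => y0 y1; rewrite (tliftE Fb) /F mul_antipode_comul.
by rewrite -!scalerAr mulr1 linearZl_LR linearZr_LR.
Qed.

Lemma end_coact_amull a :
  end_coact rho (amull a) = tmap (@amull _ A) id (rho a).
Proof.
apply/esym/end_coact_uniq => v.
have [evL evE] := tmap_linear (ev_linear v) (@id_linear _ H).
rewrite [tmap (@amull _ A) _ _]/tmap (linear_tlift _ _ evL) /end_coact_at.
transitivity (tlift (fun a0 a1 => (a0 * v) ⊗ a1) (rho a)).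
  by apply: eq_tlift => a0 a1; rewrite evE lfunE.
rewrite -rho_mul_antipode; apply: eq_tlift => v0 v1.
by rewrite lfunE.
Qed.

Hypothesis rho_tracial : tracial_comodule rho.

Lemma regular_trace_rho (a : A) :
  tlift (fun a0 a1 => (regular_trace a0 : k^o) ⊗ a1) (rho a)
  = (regular_trace a : k^o) ⊗ (1 : H).
Proof.
have [trL trE] := tmap_linear rho_tracial.1 (@id_linear _ H).
rewrite -trace_amull; have := rho_tracial.2 (amull a); rewrite end_coact_amull.
rewrite /triv_coact => <-; rewrite [tmap (@amull _ A) _ _]/tmap.
rewrite (linear_tlift _ _ trL).
by apply: eq_tlift => a0 a1; rewrite trE trace_amull.
Qed.

(** By [rho_mul_antipode], [t(x_0 y) x_1] is the sum of the
[t((x y_0)_0) (x y_0)_1 S(y_1) = t(x y_0) S(y_1)]. *)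
Lemma trace_radical_rho (x y : A) : (forall z, regular_trace (x * z) = 0) ->
  tlift (fun a0 a1 => regular_trace (a0 * y) *: a1) (rho x) = 0.
Proof.
move=> tx0.
have sb : bilinear_for *:%R *:%R (fun (c : k^o) (h : H) => c *: h).
  split=> [h c d d'|d c h h'] /=; first by rewrite scalerDl -[RHS]/(c *: (d *: h) + _) scalerA.
  by rewrite scalerDr -[RHS]/(c *: (d *: h) + _) !scalerA mulrC.
have [tL tE] := tmap_linear (@regular_trace_linear _ A) (@id_linear _ H).
pose g z := tlift (fun (c : k^o) (h : H) => c *: h) (tmap (@regular_trace _ A) id z).
have gL : linear g by move=> c u v; rewrite /g tL (tlift_is_linear sb).
have gE a h : g (a ⊗ h) = regular_trace a *: h by rewrite /g tE (tliftE sb).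
transitivity (g (tlift (fun a0 a1 => (a0 * y) ⊗ a1) (rho x))).
  by rewrite (linear_tlift _ _ gL); apply: eq_tlift => a0 a1; rewrite gE.
rewrite -rho_mul_antipode (linear_tlift _ _ gL); apply: big1 => -[y0 y1] _ /=.
pose s := fun (c : k^o) (h : H) => c *: (h * antipode y1).
have sb' : bilinear_for *:%R *:%R s.
  split=> [h c d d'|d c h h']; rewrite /s /=.
    by rewrite scalerDl -[RHS]/(c *: (d *: (h * antipode y1)) + _) scalerA.
  rewrite mulrDl scalerDr -scalerAl -[RHS]/(c *: (d *: (h * antipode y1)) + _).
  by rewrite !scalerA mulrC.
have sL := tlift_is_linear sb'.
rewrite (linear_tlift _ _ gL).
transitivity (tlift s (tlift (fun a0 a1 => (regular_trace a0 : k^o) ⊗ a1) (rho (x * y0)))).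
  rewrite (linear_tlift _ _ sL); apply: eq_tlift => a0 a1.
  by rewrite gE (tliftE sb').
by rewrite regular_trace_rho (tliftE sb') tx0 /s scale0r.
Qed.

Lemma trace_radical_hcoinvariant :
  hcoinvariant rho [set x | forall y, regular_trace (x * y) = 0]%classic.
Proof.
move=> x tx0.
pose phi_fun (j : 'I_(\dim {:A})) (a : A) := regular_trace (a * (vbasis {:A})`_j).
have phiL j : linear (phi_fun j : A -> k^o).
  by move=> c a b; rewrite /phi_fun mulrDl -scalerAl linearP.
pose phi j : {scalar A} := HB.pack (phi_fun j)
  (GRing.isLinear.Build k A k^o *:%R (phi_fun j) (phiL j)).
have [s sP ->] := @tensor_sub_kernel _ A H _ phi (rho x)
  (fun j => trace_radical_rho _ tx0).
exists s => // p /sP p0 y; rewrite (coord_vbasis (memvf y)) mulr_sumr linear_sum.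
apply: big1 => j _; rewrite -scalerAr linearZ_LR.
by transitivity (coord (vbasis {:A}) j y *: (0 : k^o));
  [congr (_ *: _); exact: p0 | rewrite scaler0].
Qed.

End ComoduleAlgebra.

Theorem theorem0p2 (k : fieldType) (H : hopfAlgType k) (A : falgType k)
    (dim_lt_char : forall p : nat, p \in [pchar k] -> (\dim {:A} < p)%N) :
  (forall act : H -> A -> A,
     is_module_algebra act -> tracial_module act ->
     hinvariant act (jacobson_radical A)) /\
  (forall rho : A -> A ⊗ H,
     is_comodule_algebra rho -> tracial_comodule rho ->
     hcoinvariant rho (jacobson_radical A)).
Proof.
have -> : jacobson_radical A = [set x | forall y, regular_trace (x * y) = 0]%classic.
  by apply/seteqP; split=> x /(jacobson_traceP dim_lt_char).
split=> [act actP trP | rho rhoP trP].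
  exact: trace_radical_hinvariant.
exact: trace_radical_hcoinvariant.
Qed.
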